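(* Let $A$ be an associative, commutative and unital $\mathbb{Q}$-algebra. The set $$G^{\alpha}(A)=\left\{\alpha_f(x)=\big(x^{\mathsf{o}}-x^{\mathsf{v}}\backslash f(x)\big)^{-1}/x^{\mathsf{v}}\ :\ f\in A[[Y]]\right\}$$ coincides with the subset of $G^{\rho}_Y(A)$ made of the series $\rho_g(x)=\sum_{t\in Y}g_t\,x^{t/\mathsf{v}}$ (with $g_{\mathsf{o}}=1$) such that $$g_t=g_{V(t_1)}\,g_{V(t_2)}\cdots g_{V(t_n)}\qquad\text{whenever } t=V(t_1)/V(t_2)/\cdots/V(t_n),$$ with $n\geq 1$ and $t_1,\dots,t_n\in Y$.
   Context: A tree means a planar binary rooted tree; its order is the number of its internal (trivalent) vertices; $Y$ is the set of all trees. The root tree (order $0$) is denoted $\mathsf{o}$, the vertex tree (the unique tree of order $1$) is denoted $\mathsf{v}$. For trees $t,s$: $t/s$ (''over'') is obtained by grafting the root of $t$ on the left-most leaf of $s$; $t\backslash s$ (''under'') is obtained by grafting the root of $s$ on the right-most leaf of $t$. Both are associative with unit $\mathsf{o}$. For $t\in Y$ set $V(t)=\mathsf{v}\backslash t$. $A[[Y]]$ is the space of formal series $f(x)=\sum_{t\in Y}f_t\,x^t$, $f_t\in A$ ($x^t$ is just a symbol). The products extend bilinearly: $(f/g)(x)=\sum_{t,s}f_tg_s\,x^{t/s}$ and $(f\backslash g)(x)=\sum_{t,s}f_tg_s\,x^{t\backslash s}$. The set of series with $f_{\mathsf{o}}=1$ is a group $G^{\mathrm{over}}(A)$ for the product $/$,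 with unit $x^{\mathsf{o}}$; the inverse $(x^{\mathsf{o}}-x^{\mathsf{v}}\backslash f(x))^{-1}$ is taken in this group. Finally $G^{\rho}_Y(A)=\{\rho_g(x)=g(x)/x^{\mathsf{v}}=\sum_{t\in Y}g_t\,x^{t/\mathsf{v}} : g_t\in A,\ g_{\mathsf{o}}=1\}$. *)

(* Defs.v *)
From HB Require Import structures.
From mathcomp Require Import all_boot all_order all_algebra.
From mathcomp Require Import boolp classical_sets functions.

Set Implicit Arguments.
Unset Strict Implicit.
Unset Printing Implicit Defensive.

Import GRing.Theory.
Local Open Scope ring_scope.

(* Planar binary rooted trees: [Root] has no internal vertex, and [Graft l r]
   has a lowest internal vertex carrying [l] on the left and [r] on the
   right. *)
Inductive tree := Root | Graft of tree & tree.

Fixpoint tree_encode (t : tree) : GenTree.tree unit :=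
  if t is Graft l r then GenTree.Node 0 [:: tree_encode l; tree_encode r]
  else GenTree.Leaf tt.

Fixpoint tree_decode (u : GenTree.tree unit) : tree :=
  if u is GenTree.Node _ [:: l; r] then Graft (tree_decode l) (tree_decode r)
  else Root.

Lemma tree_encodeK : cancel tree_encode tree_decode.
Proof. by elim=> //= l -> r ->. Qed.

HB.instance Definition _ := Countable.copy tree (can_type tree_encodeK).

Definition vertex : tree := Graft Root Root.

(* t / s : the root of t is grafted on the left-most leaf of s. *)
Fixpoint tree_over (t s : tree) : tree :=
  if s is Graft l r then Graft (tree_over t l) r else t.

(* t \ s : the root of s is grafted on the right-most leaf of t. *)
Fixpoint tree_under (t s : tree) : tree :=
  if t is Graft l r then Graft l (tree_under r s) else s.

Definition V (t : tree) : tree := tree_under vertex t.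

Fixpoint height (t : tree) : nat :=
  if t is Graft l r then (maxn (height l) (height r)).+1 else 0.

Fixpoint trees (n : nat) : seq tree :=
  if n is m.+1 then
    Root :: [seq Graft l r | l <- trees m, r <- trees m]
  else [:: Root].

Lemma mem_trees n t : (t \in trees n) = (height t <= n)%N.
Proof.
elim: n t => [|n IHn] [|l r] //=; rewrite in_cons /= ltnS geq_max -!IHn.
apply/allpairsP/andP => [[[l' r'] [/= hl hr [-> ->]]]//|[hl hr]].
by exists (l, r).
Qed.

Lemma trees_uniq n : uniq (trees n).
Proof.
elim: n => [|n IHn] //=; apply/andP; split.
  by apply/negP => /allpairsP [p []].
by apply: allpairs_uniq => // -[l r] [l' r'] _ _ /= [<- <-].
Qed.

(* The pairs (t, s) with [op t s = u]. For [op] one of [tree_over] and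
   [tree_under] the bound on the height loses none of them (see
   [mem_factors_over] and [mem_factors_under]). *)
Definition factors (op : tree -> tree -> tree) (u : tree) :
    seq (tree * tree) :=
  [seq p <- [seq (t, s) | t <- trees (height u), s <- trees (height u)]
     | op p.1 p.2 == u].

Lemma factors_uniq op u : uniq (factors op u).
Proof.
apply/filter_uniq/allpairs_uniq; rewrite ?trees_uniq //.
by move=> [? ?] [? ?].
Qed.

Lemma mem_factors op u p :
  (forall t s, height t <= height (op t s) /\ height s <= height (op t s))%N ->
  (p \in factors op u) = (op p.1 p.2 == u).
Proof.
move=> hop; rewrite mem_filter; case: eqP => //= <-; case: p => t s /=.
by have [ht hs] := hop t s; rewrite allpairs_f // mem_trees.
Qed.

Lemma height_over t s :
  (height t <= height (tree_over t s) /\ height s <= height (tree_over t s))%N.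
Proof.
elim: s => [|l [ht hl] r _] //=; split.
  by rewrite (leq_trans ht) // leqW // leq_maxl.
by rewrite ltnS geq_max leq_maxr leq_max hl.
Qed.

Lemma height_under t s :
  (height t <= height (tree_under t s) /\
   height s <= height (tree_under t s))%N.
Proof.
elim: t => [|l _ r [hr hs]] //=; split.
  by rewrite ltnS geq_max leq_maxl leq_max hr orbT.
by rewrite (leq_trans hs) // leqW // leq_maxr.
Qed.

Lemma mem_factors_over u p :
  (p \in factors tree_over u) = (tree_over p.1 p.2 == u).
Proof. exact/mem_factors/height_over. Qed.

Lemma mem_factors_under u p :
  (p \in factors tree_under u) = (tree_under p.1 p.2 == u).
Proof. exact/mem_factors/height_under. Qed.

(* A[[Y]]: the coefficient of x^t in f is [f t]. *)
Notation series A := (tree -> A).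

Definition monomial {A : comPzRingType} (t : tree) : series A :=
  fun u => (u == t)%:R.

(* The bilinear extension of an operation on trees that never lowers the
   height, so that [factors] is complete. *)
Definition series_op {A : comPzRingType} (op : tree -> tree -> tree)
    (f g : series A) : series A :=
  fun u => \sum_(p <- factors op u) f p.1 * g p.2.

Definition series_over {A : comPzRingType} : series A -> series A -> series A :=
  series_op tree_over.

Definition series_under {A : comPzRingType} :
  series A -> series A -> series A := series_op tree_under.

Section OverGroup.
Variable A : comPzRingType.
Implicit Types f g h : series A.

Lemma series_over_root f g : series_over f g Root = f Root * g Root.
Proof.
by rewrite /series_over /series_op (perm_big [:: (Root, Root)]) ?big_seq1.
Qed.

Lemma factors_over_graft l r :
  perm_eq (factors tree_over (Graft l r))
    ((Graft l r, Root) :: [seq (p.1, Graft p.2 r) | p <- factors tree_over l]).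
Proof.
apply: uniq_perm; first exact: factors_uniq.
  rewrite /= map_inj_uniq ?factors_uniq ?andbT; last first.
    by move=> [? ?] [? ?] /= [-> ->].
  by apply/negP => /mapP [].
move=> [t s]; rewrite mem_factors_over inE /=; case: s => [|s1 s2] /=.
  rewrite xpair_eqE eqxx andbT; case: eqP => //= _.
  by apply/esym/negP => /mapP [].
rewrite xpair_eqE andbF /=.
apply/eqP/mapP => [[<- <-]|[[t' s'] + [-> -> ->]]].
  by exists (t, s1); rewrite // mem_factors_over.
by rewrite mem_factors_over /= => /eqP ->.
Qed.

Lemma series_over_graft f g l r :
  series_over f g (Graft l r) =
  f (Graft l r) * g Root + series_over f (fun s => g (Graft s r)) l.
Proof.
rewrite /series_over /series_op (perm_big _ (factors_over_graft l r)) /=.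
by rewrite big_cons big_map.
Qed.

Lemma series_overA : associative (@series_over A).
Proof.
have overDr f g h t : series_over f (fun s => g s + h s) t =
    series_over f g t + series_over f h t.
  rewrite /series_over /series_op -big_split /=.
  by apply: eq_bigr => p _; rewrite mulrDr.
have overZr f g c t : series_over f (fun s => g s * c) t =
    series_over f g t * c.
  rewrite /series_over /series_op mulr_suml; apply: eq_bigr => p _.
  by rewrite mulrA.
move=> f g h; apply/funext => t; elim: t h => [|l IHl r _] h.
  by rewrite !series_over_root mulrA.
rewrite !series_over_graft -IHl series_over_root mulrDl -mulrA -addrA.
congr (_ + _); rewrite -overZr -overDr; congr (series_over f _ l).
by apply/funext => s; rewrite series_over_graft.
Qed.

Lemma series_over1s : left_id (monomial Root) (@series_over A).
Proof.
move=> f; apply/funext => t; elim: t f => [|l IHl r _] f.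
  by rewrite series_over_root mul1r.
by rewrite series_over_graft IHl mul0r add0r.
Qed.

Lemma series_overs1 : right_id (monomial Root) (@series_over A).
Proof.
move=> f; apply/funext => -[|l r]; first by rewrite series_over_root mulr1.
rewrite series_over_graft mulr1 /series_over /series_op big1 ?addr0 // => p _.
exact: mulr0.
Qed.

(* [inv_over_aux f t g] is the coefficient of x^t in f^-1 / g. *)
Fixpoint inv_over_aux f (t : tree) (g : series A) : A :=
  if t is Graft l r then
    - inv_over_aux f l (fun s => f (Graft s r)) * g Root
    + inv_over_aux f l (fun s => g (Graft s r))
  else g Root.

Definition inv_over f : series A := fun t =>
  if t is Graft l r then - inv_over_aux f l (fun s => f (Graft s r)) else 1.

Lemma inv_over_auxE f g t :
  inv_over_aux f t g = series_over (inv_over f) g t.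
Proof.
elim: t g => [|l IHl r _] g /=; first by rewrite series_over_root mul1r.
by rewrite series_over_graft -!IHl.
Qed.

Lemma inv_overP f : f Root = 1 -> series_over (inv_over f) f = monomial Root.
Proof.
move=> f1; apply/funext => -[|l r]; first by rewrite series_over_root f1 mulr1.
by rewrite series_over_graft f1 mulr1 /= inv_over_auxE addNr.
Qed.

(* The group G^over(A); its operations are the generic ones of [groupType]
   (in group_scope). *)
Record Gover := MkGover {
  gover_val :> series A;
  gover_valP : gover_val Root == 1
}.

HB.instance Definition _ := [isSub for gover_val].
HB.instance Definition _ := [Choice of Gover by <:].

Definition gover_mul (f g : Gover) : Gover.
Proof.
exists (series_over f g).
by rewrite series_over_root (eqP (gover_valP f)) (eqP (gover_valP g)) mulr1.
Defined.

Definition gover_one : Gover := @MkGover (monomial Root) (eqxx _).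

Definition gover_inv (f : Gover) : Gover :=
  @MkGover (inv_over f) (eqxx _).

Lemma gover_mulA : associative gover_mul.
Proof. by move=> f g h; apply/val_inj/series_overA. Qed.

Lemma gover_mul1g : left_id gover_one gover_mul.
Proof. by move=> f; apply/val_inj/series_over1s. Qed.

Lemma gover_mulg1 : right_id gover_one gover_mul.
Proof. by move=> f; apply/val_inj/series_overs1. Qed.

Lemma gover_mulVg : left_inverse gover_one gover_inv gover_mul.
Proof. by move=> f; apply/val_inj/inv_overP/eqP/gover_valP. Qed.

Lemma gover_mulgV : right_inverse gover_one gover_inv gover_mul.
Proof.
move=> f; rewrite -[LHS]gover_mul1g -{1}(gover_mulVg (gover_inv f)).
by rewrite -gover_mulA (gover_mulA (gover_inv f)) gover_mulVg gover_mul1g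
  gover_mulVg.
Qed.

HB.instance Definition _ := isGroup.Build Gover
  gover_mulA gover_mul1g gover_mulg1 gover_mulVg gover_mulgV.

Lemma one_sub_vertex_root f :
  (monomial Root - series_under (monomial vertex) f) Root == 1.
Proof.
suff e : series_under (monomial vertex) f Root = 0.
  by rewrite !(addrfctE, opprfctE) /= e subr0.
rewrite /series_under /series_op big1_seq // => p /=; move: p.
move=> [t s] /= /[!mem_factors_under] /=; case: t => [|//] _; exact: mul0r.
Qed.

(* x^o - x^v \ f(x), as an element of G^over(A). *)
Definition one_sub_vertex f : Gover :=
  @MkGover (monomial Root - series_under (monomial vertex) f)
    (one_sub_vertex_root f).

Definition alpha f : series A :=
  series_over ((one_sub_vertex f)^-1)%g (monomial vertex).

Definition Galpha : set (series A) := [set alpha f | f in [set: series A]].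

Definition rho (g : series A) : series A := series_over g (monomial vertex).

Definition GrhoY : set (series A) :=
  [set rho g | g in [set g : series A | g Root = 1]].

End OverGroup.

Arguments Galpha A : clear implicits.
Arguments GrhoY A : clear implicits.
Arguments Gover A : clear implicits.

(* Main.v *)
Require Import Defs.
From HB Require Import structures.
From mathcomp Require Import all_boot all_order all_algebra.
From mathcomp Require Import boolp classical_sets functions.

(** Every tree is uniquely a product [V t_1 / ... / V t_n], because
    [Graft l r = l / V r]. Hence the multiplicativity of [g] amounts to the
    recursion [g (Graft l r) = g l * g (V r)], and with [f r = g (V r)] this
    recursion is, coefficient by coefficient, the equation
    [g / (x^o - x^v \ f) = x^o]. *)

Import GRing.Theory.
Local Open Scope ring_scope.
Local Open Scope classical_set_scope.

Lemma tree_overA : associative tree_over.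
Proof. by move=> t s; elim=> //= l <-. Qed.

Lemma tree_over0t : left_id Root tree_over.
Proof. by elim=> //= l ->. Qed.

Lemma tree_overt0 : right_id Root tree_over.
Proof. by []. Qed.

HB.instance Definition _ :=
  Monoid.isLaw.Build tree Root tree_over tree_overA tree_over0t tree_overt0.

(** The right subtrees met along the left-most branch; the one at the root comes last. *)
Fixpoint over_factors (t : tree) : seq tree :=
  if t is Graft l r then rcons (over_factors l) r else [::].

Lemma over_factorsK t : \big[tree_over/Root]_(s <- over_factors t) V s = t.
Proof.
elim: t => [|l IHl r _] /=; first by rewrite big_nil.
by rewrite big_rcons IHl.
Qed.

Section Multiplicative.
Variable A : comPzRingType.
Implicit Types f g : series A.

Lemma over_multiplicativeP g : g Root = 1 ->
  (forall (t : tree) (ts : seq tree),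
      (0 < size ts)%N -> t = \big[tree_over/Root]_(s <- ts) V s ->
      g t = \prod_(s <- ts) g (V s)) <->
  (forall l r, g (Graft l r) = g l * g (V r)).
Proof.
move=> g1; split=> [gM l r | gM t ts _ ->].
  have gE t : g t = \prod_(s <- over_factors t) g (V s).
    case: t => [|t1 t2]; first by rewrite big_nil.
    by apply: gM; rewrite ?over_factorsK //= size_rcons.
  by rewrite gE /= big_rcons -gE.
elim/last_ind: ts => [|ts s IHts]; first by rewrite !big_nil.
(* [tree_over u (V s)] computes to [Graft u s], so the recursion splits off the last factor. *)
by rewrite !big_rcons -IHts; apply: gM.
Qed.

(** [tree_under vertex r] computes to [Graft Root r]: a factorization with [vertex] on the left
    exists only for trees of this shape, and is then unique. *)
Lemma series_under_vertex f t :
  series_under (monomial vertex) f t = if t is Graft Root r then f r else 0.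
Proof.
rewrite /series_under /series_op.
have zero u : (forall r, u <> V r) ->
    \sum_(p <- factors tree_under u) monomial vertex p.1 * f p.2 = 0.
  move=> uV; apply: big1_seq => -[t1 t2] /=; rewrite mem_factors_under /=.
  move=> /eqP tu; rewrite /monomial; case: eqP => [tv|_]; last exact: mul0r.
  by case: (uV t2); rewrite -tu tv.
case: t => [|[|l1 l2] r]; [exact: zero | | exact: zero].
rewrite (bigD1_seq (vertex, r)) ?factors_uniq ?mem_factors_under //=.
rewrite /monomial eqxx mul1r big1_seq ?addr0 // => -[t1 t2] /=.
rewrite mem_factors_under xpair_eqE /= => /andP [tv /eqP tu].
case: eqP tv tu => [-> /= + [t2r]|*]; last exact: mul0r.
by rewrite t2r eqxx.
Qed.

Lemma series_over_one_sub_vertexP f g : g Root = 1 ->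
  series_over g (one_sub_vertex f) = monomial Root <->
  (forall l r, g (Graft l r) = g l * f r).
Proof.
move=> g1.
have hE u : gover_val (one_sub_vertex f) u =
    (u == Root)%:R - (if u is Graft Root r then f r else 0).
  by rewrite -series_under_vertex.
have overE l r : series_over g (one_sub_vertex f) (Graft l r) =
    g (Graft l r) - g l * f r.
  rewrite series_over_graft hE subr0 mulr1; congr (_ + _).
  (* As a series in [s], the coefficients of [one_sub_vertex f] at [Graft s r] are [- f r] at [Root]
     and 0 elsewhere, so only the factor pair [(l, Root)] contributes. *)
  case: l => [|l1 l2]; first by rewrite series_over_root hE sub0r mulrN.
  rewrite series_over_graft hE sub0r mulrN /series_over /series_op.
  by rewrite big1 ?addr0 // => p _; rewrite hE subr0 mulr0.
split=> [e l r | gM].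
  by apply/eqP; rewrite -subr_eq0 -overE e.
apply/funext => -[|l r]; first by rewrite series_over_root g1 hE subr0 mulr1.
by rewrite overE gM subrr.
Qed.

End Multiplicative.

Theorem lemma4p7 (A : comPzRingType) (iota : {rmorphism rat -> A}) :
  Galpha A =
  GrhoY A `&`
  [set rho g | g in [set g : series A | g Root = 1 /\
    forall (t : tree) (ts : seq tree),
      (0 < size ts)%N -> t = \big[tree_over/Root]_(s <- ts) V s ->
      g t = \prod_(s <- ts) g (V s)]].
Proof.
apply/seteqP; split=> [_ [f _ <-] | _ [_ [g [g1 gM] <-]]].
  pose g : series A := ((one_sub_vertex f)^-1)%g.
  have g1 : g Root = 1 by [].
  have /series_over_one_sub_vertexP gM :
      series_over g (one_sub_vertex f) = monomial Root.
    exact/inv_overP/eqP/gover_valP.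
  split; exists g => //; split=> //; apply/over_multiplicativeP => // l r.
  (* At [V r], which is [Graft Root r], the recursion reads [g (V r) = g Root * f r = f r]. *)
  by rewrite !gM // g1 mul1r.
move/over_multiplicativeP: gM => /(_ g1) gM.
exists (fun r => g (V r)) => //; congr series_over.
(* Inside the group, being the inverse of [one_sub_vertex f] amounts to the single equation
   [g / (x^o - x^v \ f) = x^o]. *)
pose gG := @MkGover A g (introT eqP g1).
suff -> : (one_sub_vertex (fun r => g (V r)))^-1%g = gG by [].
apply/esym/eqP; rewrite -mulg_eq1; apply/eqP/val_inj.
exact/series_over_one_sub_vertexP.
Qed.
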